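(* Let $n,a,b,t$ be positive integers with $n\ge 4$, $a,b\ge 2$, $t<\min\{a,b\}$, $a+b<n+t$, $(n,t)\ne(a+b,1)$ and $\binom{n}{a}\le\binom{n}{b}$. If $\mathcal A\subseteq\binom{[n]}{a}$ and $\mathcal B\subseteq\binom{[n]}{b}$ are nonempty and cross-$t$-intersecting, then $$|\mathcal A|+|\mathcal B|\le \binom{n}{b}-\sum_{i=0}^{t-1}\binom{a}{i}\binom{n-a}{b-i}+1.$$ Moreover: (i) when $\binom na<\binom nb$, equality holds if and only if $\mathcal A=\{A\}$ and $\mathcal B=\binom{[n]}{b}\setminus N(A)$ for some $A\in\binom{[n]}{a}$; (ii) when $\binom na=\binom nb$, equality holds if and only if either $\mathcal A=\{A\}$ and $\mathcal B=\binom{[n]}{b}\setminus N(A)$ for some $A\in\binom{[n]}{a}$, or $\mathcal B=\{B\}$ and $\mathcal A=\binom{[n]}{a}\setminus N(B)$ for some $B\in\binom{[n]}{b}$, or $a=b=2$, $t=1$ and $\mathcal A=\mathcal B=\{C\in\binom{[n]}{2}: i\in C\}$ for some $i\in[n]$, or $a=b=n-2$, $t=n-3$ and $\mathcal A=\mathcal B=\binom{A}{n-2}$ for some $A\in\binom{[n]}{n-1}$.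
   Context: $[n]=\{1,\dots,n\}$ and $\binom{S}{k}$ is the family of $k$-element subsets of $S$. Families $\mathcal A,\mathcal B$ are cross-$t$-intersecting if $|A\cap B|\ge t$ for all $A\in\mathcal A$, $B\in\mathcal B$. For $A\in\binom{[n]}{a}$, $N(A)=\{B\in\binom{[n]}{b}: |A\cap B|<t\}$, and for $B\in\binom{[n]}{b}$, $N(B)=\{A\in\binom{[n]}{a}: |A\cap B|<t\}$. *)

(* Defs.v *)
From mathcomp Require Import all_boot.

Set Implicit Arguments.
Unset Strict Implicit.
Unset Printing Implicit Defensive.

(* The ground set [n] is rendered as 'I_n = {0, ..., n-1}. *)

Definition ksubsets (T : finType) (S : {set T}) (k : nat) : {set {set T}} :=
  [set X : {set T} | (X \subset S) && (#|X| == k)].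

Definition cross_intersecting (T : finType) (t : nat) (cA cB : {set {set T}}) :
    Prop :=
  forall A B, A \in cA -> B \in cB -> t <= #|A :&: B|.

(* Both N(A), with k = b, and N(B), with k = a, are instances. *)
Definition nbhd (T : finType) (t k : nat) (X : {set T}) : {set {set T}} :=
  [set Y in ksubsets [set: T] k | #|X :&: Y| < t].

(* The outer truncated subtraction is harmless: for a <= n and t <= b.+1 the sum
   counts the b-subsets meeting a fixed a-set in fewer than t points. *)
Definition cross_bound (n a b t : nat) : nat :=
  'C(n, b) - (\sum_(0 <= i < t) 'C(a, i) * 'C(n - a, b - i)) + 1.

(* Main.v *)
(** Join A and D when |A :&: D| < t: cross-t-intersecting pairs are the
    independent sets of this bipartite graph.  If a pair (cA, cB) of maximum
    total size is uncrossed with its image under a transposition (i j), then the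
    intersection on one side and the union on the other again have maximum total
    size.  Choose (cA, cB) with the smaller side, say cA, as small as possible
    among the pairs with at least two sets on both sides: then either (i j)
    stabilises cA, or at most one member of cA fails to separate i from j.
    Two a-sets have at least C(a-1,t-1) C(n-a-1,b-t) distinguishing b-sets, which
    forces |cA| > 3; then stability is an equivalence relation with exactly two
    classes, and cA is a star {A : E <= A} with |E| = a-1 or all a-subsets of an
    (a+1)-set.  Counting distinguishing b-sets leaves only the exceptional
    parameters, while pairs with a one-element side are compared by double
    counting the non-edges. *)

Require Import Defs.
From mathcomp Require Import all_boot perm zify.

Set Implicit Arguments.
Unset Strict Implicit.
Unset Printing Implicit Defensive.

(** * Lower bounds for binomial coefficients *)

Lemma bin_ge n r : 0 < r < n -> n <= 'C(n, r).
Proof.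
elim: n r => [|n IHn] [|r] // /andP[_ rn]; rewrite binS.
case: r rn => [|r] rn; first by rewrite bin1 bin0 addn1.
have [rn2 | rn2] := leqP n r.+2.
  have -> : n = r.+2 by lia.
  by rewrite binn binSn add1n.
have := IHn r.+1; have := IHn r.+2; lia.
Qed.

Lemma bin_gt n r : 1 < r -> r.+1 < n -> n < 'C(n, r).
Proof.
case: n r => [|n] [|[|r]] //= _ rn; rewrite binS.
have := @bin_ge n r.+1; have := @bin_ge n r.+2; lia.
Qed.

Lemma bin_le_eq n r : 0 < r < n -> 'C(n, r) <= n -> r = 1 \/ r = n.-1.
Proof.
move=> rn le_n; have [|r1] := eqVneq r 1; first by left.
right; apply/eqP; apply: contraLR le_n => rn1; rewrite -ltnNge.
by apply: bin_gt; lia.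
Qed.

Lemma bin_gt2 n r : 2 < r -> r + 2 < n -> 'C(n, 2) < 'C(n, r).
Proof.
elim: n r => [|n IHn] r //= r2 rn.
have [{}rn|n_r] := ltnP (r + 3) n.+1.
  case: r r2 rn => [|r] // r2 rn; rewrite !binS bin1.
  have := IHn r.+1; have := @bin_ge n r; lia.
(* The top value of [r] is out of reach of the induction; complementation turns it into
   ['C(n.+1, 3)]. *)
have -> : r = n.+1 - 3 by lia.
rewrite bin_sub; last by lia.
rewrite !binS bin1; have := @bin_gt n 3; lia.
Qed.

(** * Counting sets by their traces, and the sizes of neighbourhoods *)

Lemma ksubsetsTE (T : finType) k (X : {set T}) :
  (X \in ksubsets [set: T] k) = (#|X| == k).
Proof. by rewrite inE subsetT. Qed.

Lemma subset_interpolate (T : finType) (X Y : {set T}) k :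
  X \subset Y -> #|X| <= k <= #|Y| ->
  exists D : {set T}, [/\ X \subset D, D \subset Y & #|D| = k].
Proof.
move=> sXY /andP[Xk kY].
have /card_gt0P[D] : 0 < #|[set D : {set T} | D \subset Y :\: X & #|D| == k - #|X|]|.
  by rewrite cards_draws bin_gt0 cardsDS // leq_sub2r.
rewrite inE subsetD => /andP[/andP[sDY dDX] /eqP cD].
exists (X :|: D); split; first exact: subsetUl.
  by rewrite subUset sXY.
by rewrite cardsU setIC disjoint_setI0 // cards0 cD subn0 subnKC.
Qed.

(** [D] is determined by its traces on [U], on [V] and outside both; with the last one fixed, the
    other two range freely over subsets of the given sizes. *)
Lemma card_prescribed_traces (T : finType) (U V W : {set T}) x y :
  [disjoint U & V] -> [disjoint W & U :|: V] ->
  #|[set D : {set T} | [&& #|D :&: U| == x, #|D :&: V| == y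
                         & D :\: (U :|: V) == W]]| = 'C(#|U|, x) * 'C(#|V|, y).
Proof.
move=> dUV dW; rewrite -!cards_draws -cardsX.
set P := [set D | _].
rewrite -(@card_in_imset _ _ (fun D => (D :&: U, D :&: V)) P); last first.
  move=> D D'; rewrite !inE => /and3P[_ _ /eqP DW] /and3P[_ _ /eqP D'W] [DU DV].
  by rewrite -(setID D (U :|: V)) -(setID D' (U :|: V)) DW D'W !setIUr DU DV.
congr #|pred_of_set _|; apply/setP=> -[X Y]; rewrite in_setX !inE /=.
apply/imsetP/idP => [[D]|/andP[/andP[sXU cX] /andP[sYV cY]]].
  by rewrite inE => /and3P[xP yP _] [-> ->]; rewrite !subsetIr xP yP.
have dWU : W :&: U = set0 by apply/disjoint_setI0/(disjointWr _ dW)/subsetUl.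
have dWV : W :&: V = set0 by apply/disjoint_setI0/(disjointWr _ dW)/subsetUr.
have dUV0 := disjoint_setI0 dUV.
have YU : Y :&: U = set0.
  by apply/eqP; rewrite -subset0 -dUV0 setIC setIS.
have XV : X :&: V = set0 by apply/eqP; rewrite -subset0 -dUV0 setSI.
exists (X :|: Y :|: W); rewrite ?inE !setIUl dWU dWV YU XV !(setU0, set0U);
  rewrite (setIidPl sXU) (setIidPl sYV) ?cX ?cY //=.
apply/eqP; rewrite !setDUl.
have /eqP-> : X :\: (U :|: V) == set0 by rewrite setD_eq0 (subset_trans sXU) ?subsetUl.
have /eqP-> : Y :\: (U :|: V) == set0 by rewrite setD_eq0 (subset_trans sYV) ?subsetUr.
by rewrite !set0U; apply/setDidPl.
Qed.

(** The non-neighbours of [A] in the bipartite graph, hence the largest family that can face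
    [[set A]]. *)
Definition conbhd (T : finType) (t b : nat) (A : {set T}) : {set {set T}} :=
  ksubsets [set: T] b :\: nbhd t b A.

Section Counting.
Variable T : finType.
Implicit Types A B D : {set T}.

Lemma in_conbhd t b A D : (D \in conbhd t b A) = (#|D| == b) && (t <= #|A :&: D|).
Proof. by rewrite !inE subsetT /=; case: eqP; rewrite ?andbT ?andbF //= -leqNgt. Qed.

(** Each step of the induction on [t] adds the layer of sets meeting [A] in exactly [t] points. The
    hypothesis keeps every [b - i] free of truncation. *)
Lemma card_nbhd t b A : t <= b.+1 ->
  #|nbhd t b A| = \sum_(0 <= i < t) 'C(#|A|, i) * 'C(#|T| - #|A|, b - i).
Proof.
elim: t => [|t IHt] tb.
  by rewrite big_nil; apply: eq_card0 => D; rewrite !inE ltn0 andbF.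
rewrite big_nat_recr //= -IHt; last exact: ltnW.
have <- : #|~: A| = #|T| - #|A| by rewrite -(cardsC A) addKn.
rewrite -(@card_prescribed_traces _ A (~: A) set0).
- rewrite -cardsUI [X in _ = _ + X]eq_card0 ?addn0; last first.
    move=> D; rewrite !inE setUCr setDT eqxx andbT setIC.
    by apply/negP=> /andP[/andP[_ lt] /andP[/eqP eqt _]]; rewrite eqt ltnn in lt.
  apply: eq_card => D; rewrite !inE subsetT setUCr setDT eqxx andbT /= ltnS.
  have := cardsID A D; rewrite setDE [D :&: A]setIC.
  by move: #|A :&: D| #|D :&: ~: A| #|D|; lia.
- by rewrite -setI_eq0 setICr.
by rewrite -setI_eq0 set0I.
Qed.

Lemma nbhd_sub t b A : nbhd t b A \subset ksubsets [set: T] b.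
Proof. by apply/subsetP=> D; rewrite inE => /andP[]. Qed.

Lemma card_ksubsetsT k : #|ksubsets [set: T] k| = 'C(#|T|, k).
Proof. by rewrite -cardsT -cards_draws. Qed.

Lemma card_conbhd t b A : t <= b ->
  (#|conbhd t b A|).+1 = cross_bound #|T| #|A| b t.
Proof.
move=> tb; rewrite /conbhd cardsDS ?nbhd_sub // card_ksubsetsT.
by rewrite card_nbhd ?(leqW tb) // /cross_bound addn1.
Qed.

(** Both sides count the pairs of an [a]-set and a [b]-set meeting in at least [t] points; the
    predecessor drops the summand 1 of [cross_bound] and leaves the size of a [conbhd]. *)
Lemma double_count a b t :
  t <= a -> t <= b ->
  'C(#|T|, a) * (cross_bound #|T| a b t).-1 = 'C(#|T|, b) * (cross_bound #|T| b a t).-1.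
Proof.
move=> ta tb; rewrite -!card_ksubsetsT -!sum_nat_const.
have E c d : t <= d -> \sum_(A in ksubsets [set: T] c) (cross_bound #|T| c d t).-1 =
    \sum_(A in ksubsets [set: T] c) \sum_(D in ksubsets [set: T] d) (t <= #|A :&: D| : nat).
  move=> td; apply: eq_bigr => A; rewrite ksubsetsTE => /eqP <-.
  rewrite -card_conbhd //= -sum1_card big_mkcond [RHS]big_mkcond /=.
  by apply: eq_bigr => D _; rewrite in_conbhd ksubsetsTE; do 2 case: ifP => //=; case: leqP.
rewrite !E // exchange_big; apply: eq_bigr => D _; apply: eq_bigr => A _.
by rewrite setIC.
Qed.

Lemma card_star a (E : {set T}) : 0 < a -> a <= #|T| -> #|E| = a.-1 ->
  #|[set A in ksubsets [set: T] a | E \subset A]| = (#|T| - a).+1.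
Proof.
move=> a0 aT cE; have cT := cardsC E; rewrite cE in cT.
have -> : (#|T| - a).+1 = 'C(#|E|, a.-1) * 'C(#|~: E|, 1).
  by rewrite cE binn bin1; move: a0 aT cT; clear; lia.
rewrite -(@card_prescribed_traces _ E (~: E) set0) ?disjoints_subset ?setCK ?sub0set //.
apply: eq_card => X; rewrite !inE subsetT setUCr setDT eqxx andbT /=.
have cX := cardsID E X; rewrite setDE in cX.
apply/andP/andP => [[/eqP XE sEX]|[/eqP XE /eqP XE']].
  by move: cX; rewrite XE (setIidPr sEX) cE eqxx; move: a0; clear; split=> //; lia.
have EX : X :&: E = E by apply/eqP; rewrite eqEcard subsetIr XE cE leqnn.
split; last by apply/setIidPr.
by rewrite -cX XE XE'; move: a0; clear; lia.
Qed.

End Counting.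

(** * Transpositions and distinguishing sets *)

Section Swap.
Variable T : finType.
Implicit Types (A B D : {set T}) (i j k : T).

Lemma card_setU1I x A D : x \notin A -> #|(x |: A) :&: D| = (x \in D) + #|A :&: D|.
Proof.
move=> xA; rewrite (cardsD1 x) !inE eqxx /=; congr (_ + #|pred_of_set _|).
by apply/setP=> y; rewrite !inE; case: eqVneq => [->|] //=; rewrite (negbTE xA).
Qed.

Definition swap i j A : {set T} := tperm i j @^-1: A.

Lemma in_swap i j A x : (x \in swap i j A) = (tperm i j x \in A).
Proof. by rewrite inE. Qed.

Lemma swapK i j : involutive (swap i j).
Proof. by move=> A; apply/setP=> x; rewrite !in_swap tpermK. Qed.

Lemma swapC i j A : swap i j A = swap j i A.
Proof. by rewrite /swap tpermC. Qed.

Lemma card_swap i j A : #|swap i j A| = #|A|.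
Proof. by apply: card_preimset; apply: perm_inj. Qed.

Lemma card_swapI i j A B : #|swap i j A :&: swap i j B| = #|A :&: B|.
Proof. by rewrite -preimsetI card_swap. Qed.

Lemma swap_id i j A : (i \in A) = (j \in A) -> swap i j A = A.
Proof. by move=> ij; apply/setP=> x; rewrite in_swap; case: tpermP => // ->. Qed.

Lemma swapE i j A : i \in A -> j \notin A -> swap i j A = j |: A :\ i.
Proof.
move=> iA jA; have nij : i != j by apply: contraNneq jA => <-.
apply/setP=> x; rewrite in_swap !inE; case: tpermP => [->|->|/eqP xi /eqP xj].
- by rewrite (negbTE jA) eqxx /= orbF (negbTE nij).
- by rewrite iA eqxx.
by rewrite xi (negbTE xj).
Qed.

(** The conjugation (i k) = (i j)(j k)(i j), which later makes stability transitive. *)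
Lemma swap_conj i j k A : i != j -> j != k -> i != k ->
  swap i k A = swap i j (swap j k (swap i j A)).
Proof.
move=> ij jk ik; apply/setP=> x; rewrite !in_swap.
suff -> : tperm i k x = tperm i j (tperm j k (tperm i j x)) by [].
have kj : k != j by rewrite eq_sym.
have ki : k != i by rewrite eq_sym.
case: (tpermP i k x) => [->|->|/eqP xi /eqP xk].
- by rewrite tpermL tpermL tpermD.
- by rewrite (tpermD ik jk) tpermR tpermR.
have [->|xj] := eqVneq x j; first by rewrite tpermR (tpermD (z:=i)) ?tpermL // eq_sym.
by rewrite !tpermD // eq_sym.
Qed.

Lemma card_swap_setI i j A D : i \in A -> j \notin A ->
  #|swap i j A :&: D| + (i \in D) = #|A :&: D| + (j \in D).
Proof.
move=> iA jA; rewrite (cardsD1 i (A :&: D)) (cardsD1 j (swap i j A :&: D)).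
have -> : (swap i j A :&: D) :\ j = (A :&: D) :\ i.
  apply/setP=> x; rewrite swapE // !inE.
  by have [->|_] := eqVneq x j; rewrite ?(negbTE jA) ?andbF //= -andbA.
by rewrite !in_setI in_swap tpermR iA; clear; lia.
Qed.

(** Moving [B] one point towards [A] creates no new distinguishing sets, by an injection: a [D] that
    already misses [B] is kept, any other contains [i] but not [j] and is transposed. The images of
    the two kinds differ in whether they meet [swap i j B] in [t] points. *)
Lemma card_conbhdD_swap t b A B i j :
  j \in A :\: B -> i \in B :\: A ->
  #|conbhd t b A :\: conbhd t b (swap i j B)| <= #|conbhd t b A :\: conbhd t b B|.
Proof.
rewrite !inE => /andP[jB jA] /andP[iA iB].
pose f D := if #|B :&: D| < t then D else swap i j D.
rewrite -(@card_in_imset _ _ f).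
  apply/subset_leq_card/subsetP=> _ /imsetP[D + ->].
  rewrite /f in_setD !in_conbhd => /andP[+ /andP[cD tA]].
  rewrite cD /= -ltnNge => ltB'.
  case: ltnP => [ltB|geB]; first by rewrite in_setD !in_conbhd cD tA -ltnNge ltB.
  rewrite in_setD !in_conbhd card_swap cD /= -(card_swapI i j) swapK -ltnNge ltB' /=.
  rewrite -(card_swapI i j) swapK swapC.
  have := card_swap_setI D iB jB; have := card_swap_setI D jA iA.
  by case: (i \in D); case: (j \in D) => /=; move: tA ltB' geB; clear; lia.
move=> D D' /setDP[+ +] /setDP[+ +]; rewrite !in_conbhd => /andP[cD _] + /andP[cD' _].
rewrite cD cD' /= -!ltnNge /f; move=> lt lt'.
case: ltnP => [_|ge]; case: ltnP => [_|ge'] //.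
- by move=> DE; rewrite DE -{1}(swapK i j B) card_swapI swapK ltnNge ge' in lt.
- by move=> DE; rewrite -DE -{1}(swapK i j B) card_swapI swapK ltnNge ge in lt'.
exact: can_inj (swapK i j) _ _.
Qed.

(** By [card_conbhdD_swap] and induction on [#|A :\: B|] it suffices to treat [A = j |: P] and
    [B = i |: P]. There any [D] with [t - 1] points in [P], containing [j] but not [i], and with
    [b - t] points outside both sets, meets [A] in [t] points and [B] in only [t - 1]. *)
Lemma card_conbhdD_ge t b A B :
  0 < t -> t <= b -> #|A| = #|B| -> A != B ->
  'C(#|A|.-1, t.-1) * 'C(#|T| - #|A|.+1, b - t) <= #|conbhd t b A :\: conbhd t b B|.
Proof.
move=> t0 tb cAB; move: {2}_.+1 (ltnSn #|A :\: B|) => q.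
elim: q B cAB => // q IHq B cAB; rewrite ltnS => le_q nAB.
have cD : #|B :\: A| = #|A :\: B|.
  by apply/eqP; rewrite -(eqn_add2l #|A :&: B|) {1}setIC !cardsID cAB.
have /set0Pn[j jAB] : A :\: B != set0.
  by apply: contraNneq nAB => AB; rewrite eqEcard cAB leqnn -setD_eq0 AB eqxx.
have /set0Pn[i iBA] : B :\: A != set0.
  by rewrite -card_gt0 cD card_gt0; apply/set0Pn; exists j.
move: (jAB) (iBA); rewrite !inE => /andP[jB jA] /andP[iA iB].
have [AB|nAB'] := eqVneq A (swap i j B); last first.
  apply: leq_trans (card_conbhdD_swap t b jAB iBA).
  apply: IHq => //; first by rewrite card_swap.
  apply: leq_trans le_q; apply: proper_card; apply/properP; split.
    apply/subsetP=> x; rewrite !inE => /andP[+ xA]; rewrite xA andbT.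
    have [xi|xi] := eqVneq x i; first by rewrite -xi xA in iA.
    by have [->|xj] := eqVneq x j; rewrite ?jB // tpermD // eq_sym.
  by exists j => //; rewrite !inE tpermR iB.
have nij : i != j by apply: contraNneq jB => <-.
pose P := A :\ j.
have cP : #|P| = #|A|.-1 by rewrite (cardsD1 j A) jA.
have BE : B = i |: P by rewrite /P -(swapE jA iA) AB swapC swapK.
have AE : A = j |: P by rewrite /P setD1K.
pose V := ~: (i |: (j |: P)).
have cV : #|V| = #|T| - #|A|.+1.
  rewrite -(cardsC (i |: (j |: P))) -AE cardsU1 iA add1n addKn //.
  by rewrite /V -AE.
rewrite -cP -cV -(@card_prescribed_traces _ P V [set j]); last first.
- by rewrite disjoints1 !inE eqxx /= orbT.
- by rewrite disjoints_subset; apply/subsetP=> x; rewrite !inE => /andP[-> ->]; rewrite !orbT.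
apply/subset_leq_card/subsetP=> D; rewrite inE => /and3P[/eqP DP /eqP DV /eqP DW].
have jD : j \in D by have := set11 j; rewrite -DW inE => /andP[].
have iD : i \notin D.
  apply: contra nij => iD; rewrite -in_set1 -DW !inE iD eqxx /= andbT.
  by rewrite (negbTE iA) andbF.
have cD' : #|D| == b.
  rewrite -(cardsID P D) DP -(cardsID V (D :\: P)) setDDl DW cards1.
  suff -> : (D :\: P) :&: V = D :&: V by rewrite DV; clear - t0 tb; lia.
  by apply/setP=> x; rewrite !inE; case: (x \in A); case: (x == j); rewrite ?orbT ?andbF.
have jP : j \notin P by rewrite !inE eqxx.
have iP : i \notin P by rewrite !inE (negbTE iA) andbF.
rewrite in_setD !in_conbhd cD' /= -ltnNge AE BE !card_setU1I // jD (negbTE iD).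
by rewrite [P :&: D]setIC DP add1n prednK // leqnn andbT.
Qed.
End Swap.

(** * Nonempty cross-intersecting pairs *)

Section CrossPairs.
Variables (T : finType) (t : nat).
Implicit Types (A B D : {set T}) (S R : {set {set T}}).

(** Boolean, so that extremal pairs can be selected with [arg_maxnP] and [arg_minnP]. *)
Definition cross_pair a b S R : bool :=
  [&& S \subset ksubsets [set: T] a, R \subset ksubsets [set: T] b,
      S != set0, R != set0 & [forall A in S, forall B in R, t <= #|A :&: B|]].

Lemma cross_pairP a b S R :
  reflect [/\ forall A, A \in S -> #|A| = a, forall B, B \in R -> #|B| = b,
              S != set0, R != set0 & cross_intersecting t S R]
          (cross_pair a b S R).
Proof.
apply: (iffP and5P) => [] [Sa Rb -> ->].
  move=> /forall_inP cr; split=> // [A /(subsetP Sa)|B /(subsetP Rb)|A B AS BR].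
  - by rewrite ksubsetsTE => /eqP.
  - by rewrite ksubsetsTE => /eqP.
  by have /forall_inP := cr A AS; apply.
move=> cr; split=> //.
- by apply/subsetP=> A /Sa cA; rewrite ksubsetsTE cA.
- by apply/subsetP=> A /Rb cA; rewrite ksubsetsTE cA.
by apply/forall_inP=> A AS; apply/forall_inP=> B; apply: cr.
Qed.

Lemma cross_pairC a b S R : cross_pair a b S R -> cross_pair b a R S.
Proof.
case/cross_pairP=> Sa Rb S0 R0 cr; apply/cross_pairP; split=> // B A BR AS.
by rewrite setIC cr.
Qed.

Definition swapf i j S : {set {set T}} := [set A | swap i j A \in S].

Lemma card_swapf i j S : #|swapf i j S| = #|S|.
Proof.
have -> : swapf i j S = swap i j @: S.
  by rewrite (can_imset_pre _ (@swapK _ i j)); apply/setP=> A; rewrite !inE.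
by rewrite card_imset //; apply: can_inj (@swapK _ i j).
Qed.

End CrossPairs.

(** * Maximum pairs whose smaller side is minimal: uncrossing and size *)

Section MinimalPair.
Variables (T : finType) (t a b s : nat).
Implicit Types (A B D : {set T}) (S R : {set {set T}}) (i j k : T).

Hypotheses (t0 : 0 < t) (ta : t < a) (tb : t < b) (abn : a + b < #|T| + t).
Hypothesis nondeg : ~ (a + b = #|T| /\ t = 1).
Hypothesis s_max : forall S R, cross_pair t a b S R -> #|S| + #|R| <= s.

Variables (cA cB : {set {set T}}).
Hypotheses (cAB : cross_pair t a b cA cB) (s_eq : #|cA| + #|cB| = s).
Hypotheses (cA1 : 1 < #|cA|) (cA_le : #|cA| <= #|cB|).
Hypothesis cA_min : forall S R, cross_pair t a b S R -> #|S| + #|R| = s ->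
  1 < #|S| -> 1 < #|R| -> #|cA| <= #|S|.

Let cA_card A : A \in cA -> #|A| = a.
Proof. by case/cross_pairP: cAB => + _ _ _ _; apply. Qed.

Let cB_card B : B \in cB -> #|B| = b.
Proof. by case/cross_pairP: cAB => _ + _ _ _; apply. Qed.

Let cAB_cross A B : A \in cA -> B \in cB -> t <= #|A :&: B|.
Proof. by case/cross_pairP: cAB => _ _ _ _; apply. Qed.

Definition stable i j := [forall A in cA, swap i j A \in cA].

(** Two distinct members not separating [i] from [j] would both survive in [cA :&: A']. Intersection
    on one side with union on the other, and the reverse, then give two cross pairs whose totals add
    up to [2 s], so both are maximum, and minimality of [cA] forces [cA :&: A' = cA], that is,
    stability. *)
Lemma unstable_inj i j A B :
  ~~ stable i j -> A \in cA -> B \in cA ->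
  (i \in A) = (j \in A) -> (i \in B) = (j \in B) -> A = B.
Proof.
move=> + AcA BcA Aij Bij; apply: contraNeq => nAB.
have [_ _ _ cB0 _] := cross_pairP _ _ _ _ _ cAB.
set A' := swapf i j cA; set B' := swapf i j cB.
have pairI : cross_pair t a b (cA :&: A') (cB :|: B').
  apply/cross_pairP; split.
  - by move=> X /setIP[/cA_card].
  - by move=> Y /setUP[/cB_card //|]; rewrite inE => /cB_card; rewrite card_swap.
  - by apply/set0Pn; exists A; rewrite !inE swap_id ?AcA.
  - by rewrite setU_eq0 negb_and cB0.
  move=> X Y /setIP[XA]; rewrite inE => XA' /setUP[YB|]; first exact: cAB_cross.
  by rewrite inE -(card_swapI i j) => YB; apply: cAB_cross.
have I2 : 1 < #|cA :&: A'|.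
  by apply/card_gt1P; exists A, B; rewrite !inE !swap_id ?AcA ?BcA.
have cU := cardsUI cA A'; have cU' := cardsUI cB B'.
rewrite !card_swapf in cU cU'.
have sI := s_max pairI.
have pairU : cross_pair t a b (cA :|: A') (cB :&: B').
  apply/cross_pairP; split.
  - by move=> Y /setUP[/cA_card //|]; rewrite inE => /cA_card; rewrite card_swap.
  - by move=> X /setIP[/cB_card].
  - by rewrite setU_eq0 negb_and; apply/orP; left; apply/set0Pn; exists A.
  (* By maximality [cB :|: B'] has at most [#|cA| + #|cB| - 2] members, so [cB :&: B'] has at least
     [#|cB| - #|cA| + 2]; this is positive because [cA] is the smaller side. *)
  - rewrite -card_gt0; move: I2 sI cU cU' s_eq cA_le; clear; lia.
  move=> X Y /setUP[XA|XA'] /setIP[YB YB']; first exact: cAB_cross.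
  by rewrite !inE in XA' YB'; rewrite -(card_swapI i j); apply: cAB_cross.
have sU := s_max pairU.
have sI' : #|cA :&: A'| + #|cB :|: B'| = s by move: sI sU cU cU' s_eq; clear; lia.
have le_I := subset_leq_card (subsetIl cA A').
have leI : #|cA| <= #|cA :&: A'| by apply: (cA_min pairI sI' I2); move: sI' s_eq cA1 cA_le le_I; clear; lia.
have /setIidPl/subsetP sub : cA :&: A' = cA by apply/eqP; rewrite eqEcard subsetIl.
by apply/forall_inP=> X /sub; rewrite inE.
Qed.

(** The pair of [[set A]] and [conbhd t b A] cannot have total size above [s], and [cB] lies inside
    [conbhd t b A]. *)
Lemma card_conbhdD_lt A : A \in cA -> #|conbhd t b A :\: cB| < #|cA|.
Proof.
move=> AcA; have [_ _ _ /set0Pn[B BcB] _] := cross_pairP _ _ _ _ _ cAB.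
have sub : cB \subset conbhd t b A.
  by apply/subsetP=> D DB; rewrite in_conbhd cB_card // eqxx cAB_cross.
have : #|[set A]| + #|conbhd t b A| <= s.
  apply/s_max/cross_pairP; split.
  - by move=> X /set1P ->; apply: cA_card.
  - by move=> D; rewrite in_conbhd => /andP[/eqP].
  - by apply/set0Pn; exists A; rewrite set11.
  - by apply/set0Pn; exists B; apply: (subsetP sub).
  by move=> X D /set1P ->; rewrite in_conbhd => /andP[].
rewrite cards1 cardsDS // ltn_subLR ?subset_leq_card // -s_eq; clear; lia.
Qed.

Lemma conbhdD_sub A B : B \in cA -> conbhd t b A :\: conbhd t b B \subset conbhd t b A :\: cB.
Proof.
move=> BcA; apply/setDS/subsetP=> D DB.
by rewrite in_conbhd cB_card // eqxx cAB_cross.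
Qed.

Lemma bin_mul_lt A B : A \in cA -> B \in cA -> A != B ->
  'C(a.-1, t.-1) * 'C(#|T| - a.+1, b - t) <= #|conbhd t b A :\: conbhd t b B|.
Proof.
move=> AcA BcA nAB; rewrite -(cA_card AcA).
by apply: card_conbhdD_ge; rewrite ?cA_card // ltnW.
Qed.

(** For [t = 1] the second factor is at least 2, otherwise the first is. In the excluded case
    [a + b = #|T|], [t = 1] both factors would be 1. *)
Lemma bin_mul_gt1 : 1 < 'C(a.-1, t.-1) * 'C(#|T| - a.+1, b - t).
Proof.
have C1 : 0 < 'C(a.-1, t.-1) by rewrite bin_gt0; clear - t0 ta tb abn; lia.
have C2 : 0 < 'C(#|T| - a.+1, b - t) by rewrite bin_gt0; clear - t0 ta tb abn; lia.
have [t1|t1] := eqVneq t 1.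
  have nab : a + b <> #|T| by move=> ?; apply: nondeg.
  have : #|T| - a.+1 <= 'C(#|T| - a.+1, b - t) by apply: bin_ge; clear - t0 ta tb abn nab t1; lia.
  move: C1; clear - tb abn nab t1; nia.
have : a.-1 <= 'C(a.-1, t.-1) by apply: bin_ge; clear - t0 ta t1; lia.
move: C2; clear - ta t0 t1; nia.
Qed.

Lemma card_conbhdD_gt1 A B : A \in cA -> B \in cA -> A != B ->
  1 < #|conbhd t b A :\: conbhd t b B|.
Proof. by move=> AcA BcA nAB; apply: leq_trans bin_mul_gt1 (bin_mul_lt AcA BcA nAB). Qed.

(** [D] is kept out of [cB] by [A], and it is not among the at least two sets distinguishing [B]
    from [C]; together they give three members of [conbhd t b B :\: cB], and [card_conbhdD_lt] adds
    one. *)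
Lemma private_conbhd_gt3 A B C D :
  A \in cA -> B \in cA -> C \in cA -> B != C ->
  D \in conbhd t b B -> D \in conbhd t b C -> D \notin conbhd t b A -> 3 < #|cA|.
Proof.
move=> AcA BcA CcA nBC DB DC DA.
apply: leq_trans (card_conbhdD_lt BcA); rewrite ltnS.
have DcB : D \notin cB.
  by apply: contra DA => DcB; rewrite in_conbhd cB_card // eqxx cAB_cross.
have /subset_leq_card : D |: (conbhd t b B :\: conbhd t b C) \subset conbhd t b B :\: cB.
  by rewrite subUset conbhdD_sub // sub1set in_setD DcB DB.
rewrite cardsU1 in_setD DC add1n; apply: leq_trans.
by rewrite ltnS; apply: card_conbhdD_gt1.
Qed.

Lemma cA_gt3 : 3 < #|cA|.
Proof.
have /card_gt2P[A [B [C [[AcA BcA CcA] [nAB nBC nCA]]]]] : 2 < #|cA|.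
  have /card_gt1P[A [B [AcA BcA nAB]]] := cA1.
  apply: leq_ltn_trans (card_conbhdD_lt AcA).
  apply: leq_trans (subset_leq_card (conbhdD_sub A BcA)).
  exact: card_conbhdD_gt1.
have nAC : A != C by rewrite eq_sym.
have nBA : B != A by rewrite eq_sym.
have diff X Y : X \in cA -> Y \in cA -> X != Y -> exists2 y, y \in Y & y \notin X.
  move=> XcA YcA nXY; apply/subsetPn; apply: contra nXY => sYX.
  by rewrite eq_sym eqEcard sYX !cA_card /=.
have cAC : #|~: A| = #|T| - a by rewrite -(cardsC A) (cA_card AcA) addKn.
(* For [t = 1], a [D] disjoint from [A] through a point of [B] and a point of [C] is private in the
   sense of [private_conbhd_gt3]. *)
have [t1|nt1] := eqVneq t 1.
  have [y yB yA] := diff A B AcA BcA nAB.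
  have [z zC zA] := diff A C AcA CcA nAC.
  have [||D [sD sDA cD]] := @subset_interpolate _ [set y; z] (~: A) b.
  - by rewrite subUset !sub1set !inE yA; apply: zA; rewrite eq_sym.
  - have nab : a + b <> #|T| by move=> ?; apply: nondeg.
    rewrite cAC cards2; move: (abn) (tb) nab; rewrite t1; clear; case: (_ != _); lia.
  move: sD; rewrite subUset !sub1set => /andP[yD zD].
  apply: (@private_conbhd_gt3 A B C D) => //; rewrite in_conbhd cD eqxx /= t1.
  - by apply/card_gt0P; exists y; rewrite inE yB.
  - by apply/card_gt0P; exists z; rewrite inE zC.
  by rewrite -leqNgt leqn0 cards_eq0 setI_eq0 disjoint_sym disjoints_subset.
(* At the extreme value of [a + b], a [D] containing the complement of [A] meets [A] in [t - 1]
   points; leaving out a point outside [B] and a point outside [C] makes it meet each of these in at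
   least [t] points. *)
have [ab1|nab1] := eqVneq (a + b).+1 (#|T| + t).
  have [y yA yB] := diff B A BcA AcA nBA.
  have [z zA zC] := diff C A CcA AcA nCA.
  have [||D [sAD sD cD]] := @subset_interpolate _ (~: A) (~: [set y; z]) b.
  - by rewrite setCS subUset !sub1set yA.
  - have := cardsC [set y; z]; rewrite cards2 cAC; move: t0 ta tb ab1 nt1; clear; case: (_ != _); lia.
  have cUI (X : {set T}) : X \in cA -> #|X :|: D| + #|X :&: D| = a + b.
    by move=> XcA; rewrite cardsUI cA_card // cD.
  have ltU (X : {set T}) x : x \notin X -> x \notin D -> #|X :|: D| < #|T|.
    move=> xX xD; rewrite -cardsT; apply: proper_card; apply/properP.
    by split=> //; exists x => //; rewrite !inE negb_or xX.
  move: sD; rewrite subsetC subUset !sub1set !inE => /andP[yD zD].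
  apply: (@private_conbhd_gt3 A B C D) => //; rewrite in_conbhd cD eqxx /=.
  - have := cUI B BcA; have := ltU B y yB yD; clear - ab1; lia.
  - have := cUI C CcA; have := ltU C z zC zD; clear - ab1; lia.
  have : A :|: D = setT.
    by apply/eqP; rewrite eqEsubset subsetT -(setUCr A) setUS.
  by have := cUI A AcA => + AD; rewrite AD cardsT; clear - ab1; lia.
(* In the remaining range both binomial factors are at least 2, so two members alone have at least
   four distinguishing sets. *)
apply: leq_ltn_trans (card_conbhdD_lt AcA).
apply: leq_trans (subset_leq_card (conbhdD_sub A BcA)).
apply: leq_trans (bin_mul_lt AcA BcA nAB).
have : a.-1 <= 'C(a.-1, t.-1) by apply: bin_ge; clear - t0 ta nt1; lia.
have : #|T| - a.+1 <= 'C(#|T| - a.+1, b - t).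
  by apply: bin_ge; clear - t0 ta tb abn nab1; lia.
clear - t0 ta tb abn nab1 nt1; nia.
Qed.

(** * Stability as an equivalence relation with two classes *)

Lemma stable_sym i j : stable i j = stable j i.
Proof. by apply/forall_inP/forall_inP => h A /h; rewrite swapC. Qed.

Lemma stable_refl i : stable i i.
Proof. by apply/forall_inP=> A AcA; rewrite swap_id. Qed.

Lemma stableP i j A : stable i j -> A \in cA -> swap i j A \in cA.
Proof. by move/forall_inP; apply. Qed.

Lemma stable_trans i j k : stable i j -> stable j k -> stable i k.
Proof.
have [->//|ij] := eqVneq i j; have [->//|jk] := eqVneq j k.
have [->|ik] := eqVneq i k; first by rewrite stable_refl.
move=> sij sjk; apply/forall_inP=> A AcA.
by rewrite (@swap_conj _ i j) //; do 3 apply: stableP => //.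
Qed.

(* Every set leaves two of any three points unseparated, so three mutually
   unstable points would leave room for at most three members of cA. *)
Lemma unstable_triangle i j k : ~~ stable i j -> ~~ stable j k -> stable i k.
Proof.
move=> uij ujk; apply: contraLR cA_gt3 => uik; rewrite -leqNgt.
pose N x y := [set A in cA | (x \in A) == (y \in A)].
have N1 x y : ~~ stable x y -> #|N x y| <= 1.
  move=> uxy; rewrite leqNgt; apply/card_gt1P=> -[A [B []]].
  rewrite !inE => /andP[AcA /eqP Axy] /andP[BcA /eqP Bxy] /eqP; apply.
  exact: unstable_inj uxy _ _ _ _.
have sub : cA \subset N i j :|: N j k :|: N i k.
  apply/subsetP=> A AcA; rewrite !inE AcA /=.
  by case: (i \in A); case: (j \in A); case: (k \in A).
apply: leq_trans (subset_leq_card sub) _.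
apply: leq_trans (leq_card_setU _ _) _; rewrite -[3]/(2 + 1) leq_add ?N1 //.
by apply: leq_trans (leq_card_setU _ _) _; rewrite -[2]/(1 + 1) leq_add ?N1.
Qed.

(** Were every transposition stable, a member [A] with smallest intersection with some [D] in [cB]
    could be improved by exchanging a point of [A :&: D] for one outside [A :|: D]; the latter
    exists since [a + b < #|T| + t]. *)
Lemma exists_unstable : exists i j, ~~ stable i j.
Proof.
have [i0|] := pickP (fun ij : T * T => ~~ stable ij.1 ij.2).
  by case: i0 => i j u; exists i, j.
move=> st; have {}st i j : stable i j by have := st (i, j); case: (stable i j).
have [_ _ /set0Pn[A0 A0cA] /set0Pn[D DcB] _] := cross_pairP _ _ _ _ _ cAB.
case: (arg_minnP (fun A => #|A :&: D|) A0cA) => A AcA minA.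
have /card_gt0P[i] := leq_trans t0 (cAB_cross AcA DcB); rewrite inE => /andP[iA iD].
have [j jAD] : exists j, j \notin A :|: D.
  apply/existsP; apply: contraLR (cAB_cross AcA DcB).
  rewrite negb_exists => /forallP all; rewrite -ltnNge.
  have /eqP AD : A :|: D == setT.
    by rewrite eqEsubset subsetT; apply/subsetP=> j _; rewrite -[_ \in _]negbK.
  have := cardsUI A D; rewrite AD cardsT (cA_card AcA) (cB_card DcB).
  by move: abn; clear; lia.
move: jAD; rewrite inE negb_or => /andP[jA jD].
have := minA _ (stableP (st i j) AcA); have := card_swap_setI D iA jA.
by rewrite iD (negbTE jD); clear; lia.
Qed.

(** The stability classes are [E] and its complement; that neither is empty is carried
    separately. *)
Definition classes (E : {set T}) := [forall i, forall j, stable i j == ((i \in E) == (j \in E))].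

Lemma classesE E i j : classes E -> stable i j = ((i \in E) == (j \in E)).
Proof. by move=> /forallP/(_ i)/forallP/(_ j)/eqP. Qed.

Lemma classesC E : classes E -> classes (~: E).
Proof.
move=> cE; apply/forallP=> i; apply/forallP=> j; rewrite (classesE _ _ cE) !inE.
by case: (i \in E); case: (j \in E).
Qed.

Lemma exists_classes : exists E i j, [/\ classes E, i \in E & j \notin E].
Proof.
have [i [j uij]] := exists_unstable.
exists [set x | stable i x], i, j; split; rewrite ?inE ?stable_refl //.
apply/forallP=> x; apply/forallP=> y; rewrite !inE; apply/eqP.
have [ix|ix] := boolP (stable i x); have [iy|iy] := boolP (stable i y) => /=.
- by apply: stable_trans iy; rewrite stable_sym.
- by apply: contraNF iy => xy; apply: stable_trans xy.
- by apply: contraNF ix => xy; apply: stable_trans iy _; rewrite stable_sym.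
by apply: unstable_triangle iy; rewrite stable_sym.
Qed.

Lemma a_ltn : a < #|T|.
Proof. by move: abn tb; clear; lia. Qed.

(** A further point [l] of [A] outside [E] could be exchanged, stably, for a point missing from [A];
    this yields a second member not separating [i] from [j], against [unstable_inj]. *)
Lemma classes_star_member E A i j : classes E -> A \in cA ->
  i \in E -> j \notin E -> j \in A -> E \subset A -> A = j |: E.
Proof.
move=> cE AcA iE jE jA sEA.
have iA := subsetP sEA i iE.
have [k kA] : exists k, k \notin A.
  apply/existsP; apply: contraLR a_ltn; rewrite negb_exists -leqNgt => /forallP all.
  by rewrite -(cA_card AcA) -cardsT subset_leq_card //; apply/subsetP=> x _; rewrite -[_ \in _]negbK.
have kE : k \notin E by apply: contra kA; apply: subsetP.
apply/eqP; rewrite eqEsubset andbC subUset sub1set jA sEA /=.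
apply/subsetP=> l lA; rewrite !inE; apply/norP=> -[lj lE].
have kl : k != l by apply: contraNneq kA => ->.
have sA : swap l k A \in cA by apply: stableP => //; rewrite (classesE _ _ cE) (negbTE kE) (negbTE lE).
have ki : k != i by apply: contraNneq kE => ->.
have li : l != i by apply: contraNneq lE => ->.
have kj : k != j by apply: contraNneq kA => ->.
have := unstable_inj (i:=i) (j:=j) _ AcA sA.
rewrite (classesE _ _ cE) iE (negbTE jE) => /(_ isT).
rewrite iA jA !in_swap !tpermD // iA jA => /(_ erefl erefl) AE.
by move: lA; rewrite AE in_swap tpermL (negbTE kA).
Qed.

(** Dual to [classes_star_member]: a second point of [E] missing from [A] could be exchanged for a
    point of [A]. *)
Lemma classes_costar_member E A i j : classes E -> A \in cA ->
  i \notin E -> j \in E -> j \notin A -> A \subset E -> A = E :\ j.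
Proof.
move=> cE AcA iE jE jA sAE.
have iA : i \notin A by apply: contra iE; apply: subsetP.
have [k kA] : exists k, k \in A.
  by apply/set0Pn; rewrite -card_gt0 cA_card //; move: ta; clear; lia.
have kE := subsetP sAE k kA.
apply/eqP; rewrite eqEsubset subsetD1 jA sAE /=.
apply/subsetP=> l; rewrite !inE => /andP[lj lE]; apply/negPn/negP=> lA.
have kl : k != l by apply: contraNneq lA => <-.
have sA : swap k l A \in cA by apply: stableP => //; rewrite (classesE _ _ cE) kE lE.
have ki : k != i by apply: contraNneq iE => <-.
have li : l != i by apply: contraNneq iE => <-.
have kj : k != j by apply: contraNneq jA => <-.
have := unstable_inj (i:=j) (j:=i) _ AcA sA.
rewrite (classesE _ _ cE) jE (negbTE iE) => /(_ isT).
rewrite (negbTE iA) (negbTE jA) !in_swap !tpermD // (negbTE iA) (negbTE jA).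
move=> /(_ erefl erefl) AE.
by move: kA; rewrite AE in_swap tpermL (negbTE lA).
Qed.

(* A member splitting both classes could be modified inside both of them while
   leaving a given pair of points unseparated. *)
Lemma classes_not_split E A i i' j j' : classes E -> A \in cA ->
  i \in E -> i' \in E -> j \notin E -> j' \notin E ->
  i \in A -> j \in A -> i' \notin A -> j' \notin A -> False.
Proof.
move=> cE AcA iE i'E jE j'E iA jA i'A j'A.
have ne (x y : T) : x \in E -> y \notin E -> x != y by move=> xE; apply: contraNneq => <-.
have ne' (x y : T) : x \in A -> y \notin A -> x != y by move=> xA; apply: contraNneq => <-.
have sA : swap j j' (swap i i' A) \in cA.
  apply: stableP; first by rewrite (classesE _ _ cE) (negbTE jE) (negbTE j'E).
  by apply: stableP => //; rewrite (classesE _ _ cE) iE i'E.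
have := unstable_inj (i:=i) (j:=j) _ AcA sA.
rewrite (classesE _ _ cE) iE (negbTE jE) => /(_ isT).
have ji : j != i by rewrite eq_sym ne.
have j'i : j' != i by rewrite eq_sym ne.
have ij' : i != j' by rewrite ne.
have i'j' : i' != j' by rewrite ne.
rewrite iA jA !in_swap tpermL !(tpermD ji j'i) tpermL (tpermD ij' i'j').
rewrite (negbTE i'A) (negbTE j'A) => /(_ erefl erefl) AE.
by move: iA; rewrite AE !in_swap (tpermD ji j'i) tpermL (negbTE i'A).
Qed.

(** Among three members one is neither [E] nor its complement, so it fails to separate some [i] in
    [E] from some [j] outside. By [classes_not_split] it contains a class if it contains [i] and
    [j], and lies inside a class if it avoids them; renaming the classes covers both choices. *)
Lemma exists_star_or_costar : exists E,
  [/\ classes E, E != set0, ~: E != set0 &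
      (exists2 j, j \notin E & j |: E \in cA) \/ (exists2 j, j \in E & E :\ j \in cA)].
Proof.
have [E [i0 [j0 [cE i0E j0E]]]] := exists_classes.
have cE' := classesC cE.
have nE : E != set0 by apply/set0Pn; exists i0.
have nE' : ~: E != set0 by apply/set0Pn; exists j0; rewrite inE.
have [A AcA /andP[AE AE']] : exists2 A, A \in cA & (A != E) && (A != ~: E).
  have /card_gt2P[A [B [C [[AcA BcA CcA] [nAB nBC nCA]]]]] := ltnW cA_gt3.
  have [AE|nAE] := eqVneq A E; have [AE'|nAE'] := eqVneq A (~: E);
    last by exists A; rewrite ?nAE.
  - by have := i0E; have := i0E; rewrite -{1}AE AE' inE => /negP.
  - have [BE'|nBE'] := eqVneq B (~: E); last by exists B; rewrite // nBE' andbT -AE eq_sym.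
    by exists C; rewrite // -{1}AE nCA -BE' eq_sym.
  - have [BE|nBE] := eqVneq B E; last by exists B; rewrite // nBE -AE' eq_sym.
    by exists C; rewrite // -{1}BE -AE' nCA eq_sym nBC.
have /existsP[i /existsP[j /and3P[iE jE /eqP ijA]]] :
    [exists i, exists j, [&& i \in E, j \notin E & (i \in A) == (j \in A)]].
  apply: contraR AE'; rewrite negb_exists => /forallP h.
  have {}h i j : i \in E -> j \notin E -> (i \in A) = (j \notin A).
    move=> iE jE; have := h i; rewrite negb_exists => /forallP/(_ j).
    by rewrite iE jE /=; case: (i \in A); case: (j \in A).
  have [i0A|i0A] := boolP (i0 \in A).
    case/eqP: AE; apply/setP=> x; have [xE|xE] := boolP (x \in E).
      by rewrite (h x j0) // -(h i0 j0).
    by have := h i0 x i0E xE; rewrite i0A; case: (x \in A).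
  apply/eqP/setP=> x; rewrite inE; have [xE|xE] := boolP (x \in E).
    by rewrite (h x j0) // -(h i0 j0) // (negbTE i0A).
  by have := h i0 x i0E xE; rewrite (negbTE i0A); case: (x \in A).
have [iA|iA] := boolP (i \in A); have jA := iA; rewrite ijA in jA.
  have [sEA|/subsetPn[i' i'E i'A]] := boolP (E \subset A).
    exists E; split=> //; left; exists j => //.
    by rewrite -(classes_star_member cE AcA iE jE jA sEA).
  have [sEA|/subsetPn[j']] := boolP (~: E \subset A).
    exists (~: E); split; rewrite ?setCK //; left; exists i; rewrite ?inE ?iE //.
    by rewrite -(@classes_star_member _ A j i) ?inE ?iE.
  by rewrite inE => j'E j'A; case: (@classes_not_split E A i i' j j').
have [sAE|/subsetPn[j' j'A j'E]] := boolP (A \subset E).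
  exists E; split=> //; right; exists i => //.
  by rewrite -(@classes_costar_member _ A j i).
have [sAE|/subsetPn[i' i'A]] := boolP (A \subset ~: E).
  exists (~: E); split; rewrite ?setCK //; right; exists j; rewrite ?inE //.
  by rewrite -(@classes_costar_member _ A i j) ?inE ?iE.
by rewrite inE negbK => i'E; case: (@classes_not_split E A i' i j' j).
Qed.

(* Otherwise moving from (cA, cB) to (cA - B, cB + D) would contradict minimality. *)
Lemma shrink_contra B D : B \in cA -> #|D| = b -> #|B :&: D| < t ->
  ~ (forall A, A \in cA -> A != B -> t <= #|A :&: D|).
Proof.
move=> BcA cD BD allA.
have DcB : D \notin cB by apply: contraTN BD => DcB; rewrite -leqNgt cAB_cross.
have cS : #|cA| = (#|cA :\ B|).+1 by rewrite (cardsD1 B) BcA.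
have cR : #|D |: cB| = (#|cB|).+1 by rewrite cardsU1 DcB.
have gt3 := cA_gt3.
have S1 : 1 < #|cA :\ B| by move: gt3 cS; clear; lia.
have R1 : 1 < #|D |: cB| by rewrite cR; move: cA1 cA_le; clear; lia.
suff p : cross_pair t a b (cA :\ B) (D |: cB).
  have := cA_min p _ S1 R1; rewrite cR -s_eq cS addSnnS => /(_ erefl).
  by rewrite ltnn.
apply/cross_pairP; split.
- by move=> A /setD1P[_ /cA_card].
- by move=> X /setU1P[->|/cB_card].
- by rewrite -card_gt0 ltnW.
- by rewrite -card_gt0 ltnW.
move=> A X /setD1P[nAB AcA] /setU1P[->|XcB]; first exact: allA.
exact: cAB_cross.
Qed.

(** * The two shapes of the smaller side and their parameters *)

Lemma exists_nested (E : {set T}) : exists2 D : {set T}, #|D| = b & (D \subset E) || (E \subset D).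
Proof.
have [bE|Eb] := leqP b #|E|.
  have [|D [_ sD cD]] := @subset_interpolate _ set0 E b (sub0set _); first by rewrite cards0.
  by exists D; rewrite ?sD.
have [|D [sD _ cD]] := @subset_interpolate _ E [set: T] b (subsetT _).
  by rewrite ltnW // cardsT; move: abn ta; clear; lia.
by exists D; rewrite ?sD ?orbT.
Qed.

Lemma classes_member E A B i j : classes E -> i \in E -> j \notin E ->
  A \in cA -> B \in cA -> (i \in A) = (j \in A) -> (i \in B) = (j \in B) -> A = B.
Proof.
move=> cE iE jE; apply: unstable_inj.
by rewrite (classesE _ _ cE) iE (negbTE jE).
Qed.

Lemma separated_class E A : E != set0 -> ~: E != set0 ->
  (forall i j, i \in E -> j \notin E -> (i \in A) != (j \in A)) -> A = E \/ A = ~: E.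
Proof.
move=> /set0Pn[i0 i0E] /set0Pn[j0]; rewrite inE => j0E sep.
have [i0A|i0A] := boolP (i0 \in A); [left|right]; apply/setP=> x; rewrite ?inE.
  have [xE|xE] := boolP (x \in E); last first.
    by have := sep i0 x i0E xE; rewrite i0A; case: (x \in A).
  have := sep i0 j0 i0E j0E; have := sep x j0 xE j0E; rewrite i0A.
  by case: (x \in A); case: (j0 \in A).
have [xE|xE] := boolP (x \in E); last first.
  by have := sep i0 x i0E xE; rewrite (negbTE i0A); case: (x \in A).
have := sep i0 j0 i0E j0E; have := sep x j0 xE j0E; rewrite (negbTE i0A).
by case: (x \in A); case: (j0 \in A).
Qed.

(** Stability yields every [k |: E], and [unstable_inj] identifies any member not separating some
    pair across the classes with one of these. Only [~: E] remains possible, and [shrink_contra]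
    removes it. *)
Lemma star_members E j : classes E -> E != set0 -> j \notin E -> j |: E \in cA ->
  #|E| = a.-1 /\ cA = [set A in ksubsets [set: T] a | E \subset A].
Proof.
move=> cE nE jE jEcA.
have cardE : #|E| = a.-1 by rewrite -(cA_card jEcA) cardsU1 jE.
have nE' : ~: E != set0 by apply/set0Pn; exists j; rewrite inE.
have allj k : k \notin E -> k |: E \in cA.
  move=> kE; have [->//|kj] := eqVneq k j.
  suff <- : swap j k (j |: E) = k |: E.
    by apply: stableP => //; rewrite (classesE _ _ cE) (negbTE jE) (negbTE kE).
  rewrite swapE ?setU11 ?inE ?negb_or ?kj //; congr (_ |: _).
  by rewrite setU1K.
have members B : B \in cA -> (E \subset B) || (B == ~: E).
  move=> BcA; apply/norP=> -[sEB nB].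
  have [BE|BE] : B = E \/ B = ~: E.
  - apply: separated_class => // i k iE kE; apply: contra sEB => /eqP ikB.
    rewrite -(@classes_member E (k |: E) B i k) ?subsetUr ?allj //.
    by rewrite !inE iE eqxx orbT.
  - by rewrite BE subxx in sEB.
  by rewrite BE eqxx in nB.
have E'cA : ~: E \notin cA.
  (* A [D] comparable with [E] meets every superset of [E] in [t] points but [~: E] in fewer: here
     [#|T| = 2a - 1], so even when [E] lies in [D] only [b - (a - 1) < t] points are left over. *)
  apply/negP=> E'cA; have [D cD nested] := exists_nested E.
  have cE' : #|~: E| = a by rewrite cA_card.
  have cET := cardsC E; have cDE := cardsID E D.
  rewrite setDE in cDE; rewrite cD cardE cE' in cDE cET.
  have DE : t <= #|E :&: D|.
    case/orP: nested => [/setIidPr->|/setIidPl->]; first by rewrite cD ltnW.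
    by rewrite cardE; move: ta; clear; lia.
  have DE' : #|~: E :&: D| < t.
    case/orP: nested => [sDE|/setIidPr sED]; last first.
      by rewrite setIC; move: cDE; rewrite sED cardE; move: abn cET ta; clear; lia.
    suff -> : ~: E :&: D = set0 by rewrite cards0.
    by apply/eqP; rewrite setI_eq0 disjoint_sym disjoints_subset setCK.
  apply: (shrink_contra E'cA cD DE') => A /members/orP[sEA _|->//].
  by apply: leq_trans DE _; rewrite subset_leq_card // setSI.
split=> //; apply/setP=> A; rewrite inE ksubsetsTE; apply/idP/andP => [AcA|[/eqP cA' sEA]].
  rewrite cA_card //; split=> //.
  by case/orP: (members A AcA) => // /eqP AE; rewrite -AE AcA in E'cA.
have [k kA kE] : exists2 k, k \in A & k \notin E.
  apply/subsetPn; apply/negP=> /subset_leq_card; rewrite cA' cardE.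
  by move: ta; clear; lia.
suff -> : A = k |: E by apply: allj.
apply/eqP; rewrite eq_sym eqEcard subUset sub1set kA sEA cardsU1 kE cardE cA'.
by move: ta; clear; lia.
Qed.

Lemma costar_members E j : classes E -> ~: E != set0 -> j \in E -> E :\ j \in cA ->
  #|E| = a.+1 /\ cA = ksubsets E a.
Proof.
move=> cE nE' jE jEcA.
have cardE : #|E| = a.+1 by rewrite (cardsD1 j) jE (cA_card jEcA).
have nE : E != set0 by apply/set0Pn; exists j.
have allj k : k \in E -> E :\ k \in cA.
  move=> kE; have [->//|kj] := eqVneq k j.
  suff <- : swap k j (E :\ j) = E :\ k.
    by apply: stableP => //; rewrite (classesE _ _ cE) jE kE.
  rewrite swapE ?in_setD1 ?kj ?kE ?eqxx //.
  apply/setP=> x; rewrite !inE; have [->|//] := eqVneq x j.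
  by rewrite jE eq_sym kj.
have members B : B \in cA -> (B \subset E) || (B == ~: E).
  move=> BcA; apply/norP=> -[sEB nB].
  have [BE|BE] : B = E \/ B = ~: E.
  - apply: separated_class => // i k iE kE; apply: contra sEB => /eqP ikB.
    rewrite -(@classes_member E (E :\ i) B i k) ?subD1set ?allj //.
    by rewrite !inE eqxx (negbTE kE) andbF.
  - by rewrite BE subxx in sEB.
  by rewrite BE eqxx in nB.
have E'cA : ~: E \notin cA.
  (* Now [#|T| = 2a + 1]. The strict bound on [#|E :&: D|] compensates for the one point of [E] that
     each other member lacks. *)
  apply/negP=> E'cA; have [D cD nested] := exists_nested E.
  have cE' : #|~: E| = a by rewrite cA_card.
  have cET := cardsC E; have cDE := cardsID E D.
  rewrite setDE in cDE; rewrite cD cardE cE' in cDE cET.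
  have DE : t < #|E :&: D|.
    case/orP: nested => [/setIidPr->|/setIidPl->]; first by rewrite cD.
    by rewrite cardE; move: ta; clear; lia.
  have DE' : #|~: E :&: D| < t.
    case/orP: nested => [sDE|/setIidPr sED]; last first.
      by rewrite setIC; move: cDE; rewrite sED cardE; move: abn cET t0; clear; lia.
    suff -> : ~: E :&: D = set0 by rewrite cards0.
    by apply/eqP; rewrite setI_eq0 disjoint_sym disjoints_subset setCK.
  apply: (shrink_contra E'cA cD DE') => A AcA; case/orP: (members A AcA) => [sAE _|->//].
  have := cardsUI A (E :&: D); rewrite (cA_card AcA) setIA (setIidPl sAE).
  have /subset_leq_card : A :|: E :&: D \subset E by rewrite subUset sAE subsetIl.
  by rewrite cardE; move: DE; clear; lia.
split=> //; apply/setP=> A; rewrite inE; apply/idP/andP => [AcA|[sAE /eqP cA']].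
  rewrite cA_card //; split=> //.
  by case/orP: (members A AcA) => // /eqP AE; rewrite -AE AcA in E'cA.
have [k kE kA] : exists2 k, k \in E & k \notin A.
  apply/subsetPn; apply/negP=> /subset_leq_card; rewrite cA' cardE.
  by clear; lia.
suff -> : A = E :\ k by apply: allj.
apply/eqP; rewrite eqEcard subsetD1 sAE kA cA' /=.
by have := cardsD1 k E; rewrite kE cardE; clear; lia.
Qed.

Lemma s_le_cross_bound A : A \in cA -> #|cA| <= #|conbhd t b A :\: cB| .+1 ->
  s <= cross_bound #|T| a b t.
Proof.
move=> AcA le; have <- : #|conbhd t b A|.+1 = cross_bound #|T| a b t.
  by rewrite card_conbhd ?(cA_card AcA) // ltnW.
have sub : cB \subset conbhd t b A.
  by apply/subsetP=> D DB; rewrite in_conbhd cB_card // eqxx cAB_cross.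
have := subset_leq_card sub; move: le; rewrite cardsDS // -s_eq; clear; lia.
Qed.

(** A [D] through [j] with [t - 1] points in [E] and [b - t] outside [A] meets [A] in exactly [t]
    points, but meets [k |: E] in [t - 1] for some [k] outside [A] and [D], so it is not in [cB].
    Counting such [D] against [card_conbhdD_lt] gives ['C(a.-1, t.-1) * 'C(#|T| - a, b - t) <= #|T|
    - a]. *)
Lemma star_parameters (E : {set T}) : #|E| = a.-1 ->
  cA = [set A in ksubsets [set: T] a | E \subset A] ->
  [/\ s <= cross_bound #|T| a b t, t = 1 & b = 2].
Proof.
move=> cE cAE.
have cT := cardsC E.
have [j jE] : exists j, j \notin E.
  have : 0 < #|~: E| by move: cT abn tb ta; rewrite cE; clear; lia.
  by move/card_gt0P=> [j]; rewrite inE; exists j.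
pose A := j |: E.
have AcA : A \in cA.
  rewrite cAE inE ksubsetsTE subsetUr andbT cardsU1 jE cE.
  by apply/eqP; move: ta; clear; lia.
have cA_le' : #|cA| <= (#|T| - a).+1.
  rewrite cAE card_star //; first by move: ta; clear; lia.
  exact: ltnW a_ltn.
pose V := ~: A.
have cV : #|V| = #|T| - a by rewrite -(cardsC A) (cA_card AcA) addKn.
have le_diff : 'C(a.-1, t.-1) * 'C(#|T| - a, b - t) <= #|conbhd t b A :\: cB|.
  rewrite -cE -cV -(@card_prescribed_traces _ E V [set j]); last first.
  - by rewrite disjoints1 !inE (negbTE jE) eqxx.
  - by rewrite disjoints_subset setCK subsetUr.
  apply/subset_leq_card/subsetP=> D; rewrite inE => /and3P[/eqP DE /eqP DV /eqP DW].
  have jD : j \in D by have := set11 j; rewrite -DW inE => /andP[].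
  have DA : #|A :&: D| = t by rewrite card_setU1I // jD setIC DE; move: t0; clear; lia.
  have cD : #|D| = b.
    by rewrite -(cardsID A D) setDE setIC DA DV subnKC // ltnW.
  rewrite in_setD in_conbhd cD DA eqxx leqnn !andbT.
  have [k kV kD] : exists2 k, k \in V & k \notin D.
    apply/subsetPn; apply/negP=> /setIidPr sVD; move: DV; rewrite sVD cV.
    by move: t0 ta tb abn; clear; lia.
  have kE : k \notin E by apply: contraL kV; rewrite !inE negbK orbC => ->.
  have k_cA : k |: E \in cA.
    rewrite cAE inE ksubsetsTE subsetUr andbT cardsU1 kE cE.
    by apply/eqP; move: ta; clear; lia.
  apply: contraL (leqnn t) => DcB; rewrite -ltnNge.
  have := cAB_cross k_cA DcB; rewrite card_setU1I // (negbTE kD) setIC DE.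
  by move: t0; clear; lia.
have lt_cA := card_conbhdD_lt AcA.
have bin_le : 'C(a.-1, t.-1) * 'C(#|T| - a, b - t) <= #|T| - a.
  by rewrite -ltnS (leq_ltn_trans le_diff) // (leq_trans lt_cA).
have C1 : 0 < 'C(a.-1, t.-1) by rewrite bin_gt0; clear - t0 ta; lia.
have C2 : #|T| - a <= 'C(#|T| - a, b - t).
  by apply: bin_ge; clear - t0 ta tb abn; lia.
have t1 : t = 1.
  apply/eqP/negPn/negP=> t1.
  have : a.-1 <= 'C(a.-1, t.-1) by apply: bin_ge; clear - t0 ta t1; lia.
  by move: C2 bin_le; clear - t0 ta tb abn t1; nia.
split=> //.
  apply: (s_le_cross_bound AcA); apply: leq_trans cA_le' _; rewrite ltnS.
  by apply: leq_trans le_diff; move: C1 C2; clear; nia.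
(* With [t = 1], the value [b - t = 1] is the claim, while [b - t = #|T| - a - 1] means
   [a + b = #|T|], the excluded case. *)
case: (@bin_le_eq (#|T| - a) (b - t)).
- by clear - t0 ta tb abn; lia.
- by move: bin_le C1; clear; nia.
- by move: t1 tb; clear; lia.
move=> bt; case: nondeg; split=> //.
by move: bt t1 tb ta abn; clear; lia.
Qed.

(** A [D] avoiding [j] with [t] points in [A] and [b - t] outside [E] meets [E :\ k] in only [t - 1]
    points whenever [k] is in [A :&: D], so it is not in [cB]. Hence
    ['C(a, t) * 'C(#|T| - a.+1, b - t) <= a], which forces the second factor to be 1 and [t] to be 1
    or [a - 1]; the former is degenerate. *)
Lemma costar_parameters (E : {set T}) : #|E| = a.+1 -> cA = ksubsets E a ->
  [/\ s <= cross_bound #|T| a b t, t = a.-1 & b = #|T| - 2].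
Proof.
move=> cE cAE.
have cT := cardsC E.
have [j jE] : exists j, j \in E by apply/set0Pn; rewrite -card_gt0 cE.
have in_cA k : k \in E -> E :\ k \in cA.
  move=> kE; rewrite cAE inE subD1set /=.
  by have := cardsD1 k E; rewrite kE cE add1n => -[->].
pose A := E :\ j.
have AcA : A \in cA by apply: in_cA.
have cA_eq : #|cA| = a.+1 by rewrite cAE cards_draws cE binSn.
have cV : #|~: E| = #|T| - a.+1 by rewrite -(cardsC E) cE addKn.
have le_diff : 'C(a, t) * 'C(#|T| - a.+1, b - t) <= #|conbhd t b A :\: cB|.
  rewrite -{1}(cA_card AcA) -cV -(@card_prescribed_traces _ A (~: E) set0); last first.
  - by rewrite disjoints_subset sub0set.
  - by rewrite disjoints_subset setCK subD1set.
  apply/subset_leq_card/subsetP=> D; rewrite inE => /and3P[/eqP DA /eqP DV /eqP DW].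
  have jD : j \notin D.
    apply/negP=> jD; have : j \in D :\: (A :|: ~: E) by rewrite !inE eqxx jE jD.
    by rewrite DW inE.
  have DE : D :&: E = D :&: A.
    by apply/setP=> x; rewrite !inE; have [->|] := eqVneq x j; rewrite ?(negbTE jD).
  have cD : #|D| = b by rewrite -(cardsID E D) setDE DE DA DV subnKC // ltnW.
  rewrite in_setD in_conbhd cD setIC DA eqxx leqnn !andbT.
  have /card_gt0P[k] : 0 < #|D :&: A| by rewrite DA.
  rewrite -DE inE => /andP[kD kE].
  apply/negP=> DcB; have := cAB_cross (in_cA k kE) DcB.
  have -> : (E :\ k) :&: D = (D :&: E) :\ k.
    by apply/setP=> x; rewrite !inE; case: (x == k); case: (x \in D); case: (x \in E).
  have := cardsD1 k (D :&: E); rewrite !inE kD kE DE DA => ->.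
  by clear; lia.
have lt_cA := card_conbhdD_lt AcA.
have bin_le : 'C(a, t) * 'C(#|T| - a.+1, b - t) <= a.
  by rewrite -ltnS (leq_ltn_trans le_diff) // -cA_eq.
have C1 : a <= 'C(a, t) by apply: bin_ge; rewrite t0.
have C2 : 0 < 'C(#|T| - a.+1, b - t).
  by rewrite bin_gt0; clear - t0 ta tb abn; lia.
have bE : b - t = #|T| - a.+1.
  apply/eqP/negPn/negP=> nbE.
  have : #|T| - a.+1 <= 'C(#|T| - a.+1, b - t).
    by apply: bin_ge; clear - t0 ta tb abn nbE; lia.
  by move: C1 bin_le; clear - t0 ta tb abn nbE; nia.
have tE : t = a.-1.
  case: (@bin_le_eq a t) => //; first by rewrite t0.
    by move: bin_le C2; clear; nia.
  move=> t1; case: nondeg; split=> //.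
  by move: bE t1 tb ta abn; clear; lia.
split=> //; last by move: bE tE t0 tb ta abn; clear; lia.
apply: (s_le_cross_bound AcA); rewrite cA_eq ltnS.
by apply: leq_trans le_diff; move: C1 C2; clear; nia.
Qed.

Lemma minimal_pair_shape :
  s <= cross_bound #|T| a b t /\
  ([/\ t = 1, b = 2 & exists2 E : {set T}, #|E| = a.-1 &
      cA = [set A in ksubsets [set: T] a | E \subset A]] \/
   [/\ t = a.-1, b = #|T| - 2 & exists2 E : {set T}, #|E| = a.+1 & cA = ksubsets E a]).
Proof.
have [E [cE nE nE' [[j jE jEcA]|[j jE jEcA]]]] := exists_star_or_costar.
  have [cardE cAE] := star_members cE nE jE jEcA.
  have [le t1 b2] := star_parameters cardE cAE.
  by split=> //; left; split=> //; exists E.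
have [cardE cAE] := costar_members cE nE' jE jEcA.
have [le tE bE] := costar_parameters cardE cAE.
by split=> //; right; split=> //; exists E.
Qed.

End MinimalPair.

(** * Comparing and evaluating the bounds *)

Lemma cross_bound_gt0 n a b t : 0 < cross_bound n a b t.
Proof. by rewrite /cross_bound addn1. Qed.

Lemma cross_bound_ge (T : finType) a b t :
  t <= a <= #|T| -> t <= b -> 'C(#|T|, a) <= 'C(#|T|, b) ->
  cross_bound #|T| b a t <= cross_bound #|T| a b t.
Proof.
move=> /andP[ta aT] tb le_ab; have := @double_count T a b t ta tb.
have := cross_bound_gt0 #|T| a b t; have := cross_bound_gt0 #|T| b a t.
have : 0 < 'C(#|T|, a) by rewrite bin_gt0.
move: le_ab; move: (cross_bound _ a b t) (cross_bound _ b a t) 'C(_, _) 'C(_, _).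
by move=> x y p q; clear; nia.
Qed.

(** Converse comparison from [double_count]; a bound above 1 means that the common count is not
    forced to vanish, so the factor can be cancelled. *)
Lemma cross_bound_le_bin (T : finType) a b t :
  t <= a -> t <= b -> 1 < cross_bound #|T| b a t ->
  cross_bound #|T| a b t <= cross_bound #|T| b a t -> 'C(#|T|, b) <= 'C(#|T|, a).
Proof.
move=> ta tb; have := @double_count T a b t ta tb.
move: (cross_bound _ a b t) (cross_bound _ b a t) 'C(_, _) 'C(_, _).
by move=> x y p q; clear; nia.
Qed.

Lemma cross_bound_star n : 3 < n -> cross_bound n 2 2 1 = (n.-1).*2.
Proof.
case: n => [|[|[|n]]] // _; rewrite /cross_bound big_nat1 bin0 mul1n.
by rewrite subn0 subn2 !binS !bin0 !bin1 /=; clear; lia.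
Qed.

Lemma cross_bound_costar n : 3 < n -> cross_bound n (n - 2) (n - 2) (n - 3) = (n.-1).*2.
Proof.
move=> n3; have -> : n - 3 = (n - 4).+1 by lia.
(* Only the term [i = n - 4] survives: for smaller [i] the factor ['C(2, n - 2 - i)] is zero. *)
rewrite /cross_bound big_nat_recr //= big1_seq ?add0n; last first.
  move=> i; rewrite mem_index_iota => /andP[_ /andP[_ lt]].
  by rewrite ['C(n - (n - 2), _)]bin_small ?muln0 //; lia.
rewrite bin_sub; last by lia.
have -> : n - (n - 2) = 2 by lia.
have -> : n - 2 - (n - 4) = 2 by lia.
have -> : n - 4 = n - 2 - 2 by lia.
rewrite bin_sub; last by lia.
rewrite binn muln1.
case: n n3 => [|[|[|n]]] // _; rewrite subn2 !binS !bin0 !bin1 /=; lia.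
Qed.

(** * From minimal pairs to the bound and the equality cases *)

Section CrossTheorem.
Variables (T : finType) (t : nat).
Implicit Types (A B D E : {set T}) (S R cA cB : {set {set T}}).

Let admissible a b := [/\ 0 < t, t < a, t < b, a + b < #|T| + t
  & ~ (a + b = #|T| /\ t = 1)].

Let cross_max a b s := forall S R, cross_pair t a b S R -> #|S| + #|R| <= s.

Let nontrivial a b s S R :=
  [&& cross_pair t a b S R, #|S| + #|R| == s, 1 < #|S| & 1 < #|R|].

Lemma admissibleC a b : admissible a b -> admissible b a.
Proof. by case=> t0 ta tb abn nd; split; rewrite // addnC. Qed.

Lemma cross_maxC a b s : cross_max a b s -> cross_max b a s.
Proof. by move=> mx S R /cross_pairC /mx; rewrite addnC. Qed.

Lemma nontrivialC a b s S R : nontrivial a b s S R -> nontrivial b a s R S.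
Proof.
by case/and4P=> /cross_pairC p sE S1 R1; apply/and4P; split; rewrite // addnC.
Qed.

Lemma nontrivial_shape a b s cA cB :
  admissible a b -> cross_max a b s -> nontrivial a b s cA cB -> #|cA| <= #|cB| ->
  (forall S R, nontrivial a b s S R -> #|cA| <= #|S|) ->
  s <= cross_bound #|T| a b t /\
  ([/\ t = 1, b = 2 & exists2 E : {set T}, #|E| = a.-1 &
      cA = [set A in ksubsets [set: T] a | E \subset A]] \/
   [/\ t = a.-1, b = #|T| - 2 & exists2 E : {set T}, #|E| = a.+1 & cA = ksubsets E a]).
Proof.
case=> t0 ta tb abn nd mx /and4P[p /eqP sE A1 B1] AB mn.
apply: (@minimal_pair_shape T t a b s t0 ta tb abn nd mx cA cB) => // S R pSR sSR S1 R1.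
by apply: (mn S R); apply/and4P; split=> //; apply/eqP.
Qed.

Lemma exists_nontrivial_min a b s S R : nontrivial a b s S R ->
  exists S' R', nontrivial a b s S' R' /\ forall S'' R'', nontrivial a b s S'' R'' ->
    minn #|S'| #|R'| <= minn #|S''| #|R''|.
Proof.
move=> nt; pose P (X : {set {set T}} * {set {set T}}) := nontrivial a b s X.1 X.2.
case: (@arg_minnP _ (S, R) P (fun X => minn #|X.1| #|X.2|) nt) => -[S' R'] nt' mn.
by exists S', R'; split=> // S'' R'' nt''; apply: (mn (S'', R'')).
Qed.

(** [m] is the size of the smaller side: a star on an [(a - 1)]-set, or all [a]-subsets of an
    [(a + 1)]-set. *)
Let exceptional a b m :=
  [/\ t = 1, b = 2 & m = (#|T| - a).+1] \/ [/\ t = a.-1, b = #|T| - 2 & m = a.+1].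

Lemma nontrivial_params_oriented a b s cA cB :
  admissible a b -> cross_max a b s -> nontrivial a b s cA cB -> #|cA| <= #|cB| ->
  (forall S R, nontrivial a b s S R -> minn #|cA| #|cB| <= minn #|S| #|R|) ->
  exists m, [/\ forall S R, nontrivial a b s S R -> m <= #|S| /\ m <= #|R|,
     s <= cross_bound #|T| a b t & exceptional a b m].
Proof.
move=> adm mx nt AB mn; rewrite (minn_idPl AB) in mn.
have [|le shape] := nontrivial_shape adm mx nt AB.
  by move=> S R /mn; rewrite leq_min => /andP[].
exists #|cA|; split=> //; first by move=> S R /mn; rewrite leq_min => /andP[].
case: adm => t0 ta tb abn nd.
case: shape => [[t1 b2 [E cE ->]]|[tE bE [E cE ->]]]; [left|right]; split=> //.
  by rewrite card_star //; move: ta tb abn; clear; lia.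
by rewrite cards_draws cE binSn.
Qed.

(** Either side may be the smaller one, hence the two alternatives with [a] and [b] exchanged. That
    [m] bounds both sides of every nontrivial maximum pair is what settles equality later. *)
Lemma nontrivial_params a b s cA cB :
  admissible a b -> cross_max a b s -> nontrivial a b s cA cB ->
  exists m, (forall S R, nontrivial a b s S R -> m <= #|S| /\ m <= #|R|) /\
    (s <= cross_bound #|T| a b t /\ exceptional a b m \/
     s <= cross_bound #|T| b a t /\ exceptional b a m).
Proof.
move=> adm mx /exists_nontrivial_min[S [R [nt mn]]].
have [SR|/ltnW RS] := leqP #|S| #|R|.
  have [m [mm le ex]] := nontrivial_params_oriented adm mx nt SR mn.
  by exists m; split=> //; left.
have [|m [mm le ex]] :=
  nontrivial_params_oriented (admissibleC adm) (cross_maxC mx) (nontrivialC nt) RS.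
  by move=> S' R' /nontrivialC /mn; rewrite minnC [in X in _ <= X]minnC.
exists m; split; last by right.
by move=> S' R' /nontrivialC /mm[].
Qed.

Lemma cross_pair_le_singleton a b A R :
  t <= b -> cross_pair t a b [set A] R ->
  #|A| = a /\ R \subset conbhd t b A.
Proof.
move=> tb /cross_pairP[Sa Rb _ _ cr]; split; first by apply: Sa; rewrite set11.
by apply/subsetP=> D DR; rewrite in_conbhd Rb // eqxx cr ?set11.
Qed.

(** A pair of maximum total either has a one-element side, whose partner lies in a [conbhd], or
    falls under [nontrivial_params]; if the roles of [a] and [b] come out exchanged,
    [cross_bound_ge] repairs this. *)
Lemma cross_pair_sum_le a b cA cB :
  admissible a b -> 'C(#|T|, a) <= 'C(#|T|, b) -> cross_pair t a b cA cB ->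
  #|cA| + #|cB| <= cross_bound #|T| a b t.
Proof.
move=> adm le_ab p0; have [t0 ta tb abn nd] := adm.
pose P (X : {set {set T}} * {set {set T}}) := cross_pair t a b X.1 X.2.
case: (@arg_maxnP _ (cA, cB) P (fun X => #|X.1| + #|X.2|) p0) => -[S R] pSR mx.
apply: leq_trans (mx (cA, cB) p0) _ => /=; rewrite /P /= in pSR.
have le_ba : cross_bound #|T| b a t <= cross_bound #|T| a b t.
  apply: cross_bound_ge le_ab; last exact: ltnW.
  by move: ta tb abn; clear; lia.
have one c d S' R' : t <= d -> #|S'| = 1 -> cross_pair t c d S' R' ->
    #|S'| + #|R'| <= cross_bound #|T| c d t.
  move=> td S1; rewrite S1; move/eqP/cards1P: S1 => [A ->] /(cross_pair_le_singleton td)[<- sR].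
  by rewrite -card_conbhd // add1n ltnS subset_leq_card.
have [_ _ S0 R0 _] := cross_pairP _ _ _ _ _ pSR; rewrite -!card_gt0 in S0 R0.
have [S1|S1] := eqVneq #|S| 1; first by apply: one pSR; rewrite // ltnW.
have [R1|R1] := eqVneq #|R| 1.
  apply: leq_trans le_ba; rewrite addnC.
  by apply: one (cross_pairC pSR); rewrite // ltnW.
have nt : nontrivial a b (#|S| + #|R|) S R.
  by apply/and4P; split; rewrite // ltn_neqAle eq_sym ?S1 ?R1.
have mx' : cross_max a b (#|S| + #|R|) by move=> S' R' p; apply: (mx (S', R') p).
have [m [_ [[]//|[le _]]]] := nontrivial_params adm mx' nt.
exact: leq_trans le_ba.
Qed.

(** Since [b] is 2 or [#|T| - 2], the binomial hypothesis and [bin_gt2] push [a] to one of the two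
    ends as well; the opposite end would give [a + b = #|T|] with [t = 1]. *)
Lemma exceptional_params a b m : 1 < a -> 1 < b ->
  admissible a b -> 'C(#|T|, a) <= 'C(#|T|, b) -> exceptional a b m ->
  [/\ m = #|T|.-1, a = b & [/\ b = 2 & t = 1] \/ [/\ b = #|T| - 2 & t = #|T| - 3]].
Proof.
move=> a1 b1 [t0 ta tb abn nd] le_ab ex.
have a_small : a <= 2 \/ #|T| <= a + 2.
  have [a2|a2] := leqP a 2; [by left|right].
  rewrite leqNgt; apply/negP=> aT; have := bin_gt2 a2 aT.
  rewrite ltnNge; move/negP; apply.
  case: ex => [[_ b2 _]|[_ b2 _]]; first by rewrite -b2.
  by move: le_ab; rewrite b2 bin_sub //; move: aT a2; clear; lia.
have nab : t = 1 -> a + b <> #|T| by move=> t1 ab; apply: nd.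
case: ex => [[t1 b2 mE]|[tE bE mE]].
  have nab' := nab t1; have a2 : a = 2.
    by move: a_small nab' a1 abn t1 b2; clear; lia.
  split; [|by rewrite a2 b2|by left].
  by rewrite mE a2; move: abn; rewrite t1 b2 a2; clear; lia.
have a2 : a <> 2.
  move=> a2; have t1 : t = 1 by rewrite tE a2.
  by apply: (nab t1); rewrite a2 bE; move: abn b1 t1 a2 bE; clear; lia.
have aE : a = #|T| - 2.
  by move: a_small a2 a1 tb tE bE b1; clear; lia.
split; [|by rewrite aE|right; split=> //].
  by rewrite mE; move: aE a1; clear; lia.
by move: tE aE; clear; lia.
Qed.

Lemma exists_pair_outside (x y : T) : 3 < #|T| ->
  exists u v, [/\ u != v, u != x, u != y, v != x & v != y].
Proof.
move=> n3; have /card_gt1P[u [v [+ + uv]]] : 1 < #|~: [set x; y]|.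
  have := cardsC [set x; y]; rewrite cards2; move: n3; clear.
  by case: (_ != _); lia.
rewrite !inE !negb_or => /andP[ux uy] /andP[vx vy].
by exists u, v.
Qed.

(** With distinct centres [i] and [j], two further points [u] and [v] give disjoint pairs
    [[set i; u]] and [[set j; v]]. *)
Lemma cross_star_eq (E F : {set T}) : 3 < #|T| -> #|E| = 1 -> #|F| = 1 ->
  cross_intersecting 1 [set A in ksubsets [set: T] 2 | E \subset A]
    [set A in ksubsets [set: T] 2 | F \subset A] ->
  exists2 i, E = [set i] & F = [set i].
Proof.
move=> n3 /eqP/cards1P[i ->] /eqP/cards1P[j ->] cr.
suff -> : i = j by exists j.
apply/eqP/negPn/negP=> ij.
have [u [v [uv ui uj vi vj]]] := exists_pair_outside i j n3.
have mem (x y : T) : x != y -> [set x; y] \in [set A in ksubsets [set: T] 2 | [set x] \subset A].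
  by move=> xy; rewrite inE ksubsetsTE cards2 xy sub1set !inE eqxx.
rewrite eq_sym in ui; rewrite eq_sym in vj.
have := cr _ _ (mem i u ui) (mem j v vj); rewrite card_gt0 => /set0Pn[x].
rewrite !inE => /andP[/orP[]/eqP-> /orP[]].
- by rewrite (negbTE ij).
- by rewrite eq_sym (negbTE vi).
- by rewrite (negbTE uj).
- by rewrite (negbTE uv).
Qed.

Lemma cross_costar_eq (E F : {set T}) : 3 < #|T| -> #|E| = #|T|.-1 -> #|F| = #|T|.-1 ->
  cross_intersecting (#|T| - 3) (ksubsets E (#|T| - 2)) (ksubsets F (#|T| - 2)) -> E = F.
Proof.
move=> n3 cE cF cr.
have compl (X : {set T}) : #|X| = #|T|.-1 -> exists i, X = [set~ i].
  move=> cX; have /eqP/cards1P[i XE] : #|~: X| = 1.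
    by have := cardsC X; rewrite cX; move: n3; clear; lia.
  by exists i; rewrite -XE setCK.
have [i Ei] := compl E cE; have [j Fj] := compl F cF; subst E F.
suff -> : i = j by [].
apply/eqP/negPn/negP=> ij.
have [u [v [uv ui uj vi vj]]] := exists_pair_outside i j n3.
have mem (x y : T) : y != x -> [set~ x] :\ y \in ksubsets [set~ x] (#|T| - 2).
  move=> yx; rewrite inE subD1set /=; have := cardsD1 y [set~ x].
  by rewrite !inE yx cardsC1 add1n subn2 => ->.
have iu := mem i u ui; have jv := mem j v vj.
have := cr _ _ iu jv; have := cardsUI ([set~ i] :\ u) ([set~ j] :\ v).
(* The two [(#|T| - 2)]-sets have disjoint complements, so they meet in only [#|T| - 4] points. *)
have -> : [set~ i] :\ u :|: ([set~ j] :\ v) = setT.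
  apply/setP=> x; rewrite !inE; have [->|xi] := eqVneq x i.
    by rewrite andbF /= eq_sym vi ij.
  have [->|xu] := eqVneq x u; last by [].
  by rewrite uv uj.
move: iu jv; rewrite !inE => /andP[_ /eqP->] /andP[_ /eqP->]; rewrite cardsT.
by move: n3; clear; lia.
Qed.

Lemma cross_bound_eq a b : t <= a <= #|T| -> t <= b <= #|T| ->
  'C(#|T|, a) = 'C(#|T|, b) -> cross_bound #|T| a b t = cross_bound #|T| b a t.
Proof.
move=> aE bE eq_ab; have [/andP[ta _] /andP[tb _]] := (aE, bE).
by apply/eqP; rewrite eqn_leq !cross_bound_ge ?eq_ab.
Qed.

Lemma equality_cases a b cA cB : 1 < a -> 1 < b -> 3 < #|T| ->
  admissible a b -> 'C(#|T|, a) <= 'C(#|T|, b) -> cross_pair t a b cA cB ->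
  #|cA| + #|cB| = cross_bound #|T| a b t ->
  (exists2 A, A \in ksubsets [set: T] a & cA = [set A] /\ cB = conbhd t b A) \/
  'C(#|T|, a) = 'C(#|T|, b) /\
  [\/ exists2 B, B \in ksubsets [set: T] b & cB = [set B] /\ cA = conbhd t a B,
      [/\ a = 2, b = 2, t = 1 & exists i,
         cA = [set C in ksubsets [set: T] 2 | i \in C] /\
         cB = [set C in ksubsets [set: T] 2 | i \in C]]
    | [/\ a = #|T| - 2, b = #|T| - 2, t = #|T| - 3 &
         exists2 A, A \in ksubsets [set: T] (#|T| - 1) &
           cA = ksubsets A (#|T| - 2) /\ cB = ksubsets A (#|T| - 2)]].
Proof.
move=> a1 b1 n3 adm le_ab p sumE.
have [t0 ta tb abn nd] := adm.
have [_ _ A0 B0 _] := cross_pairP _ _ _ _ _ p; rewrite -!card_gt0 in A0 B0.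
have swap_bin : cross_bound #|T| a b t <= cross_bound #|T| b a t -> 'C(#|T|, a) = 'C(#|T|, b).
  move=> le; apply/eqP; rewrite eqn_leq le_ab /=.
  apply: (cross_bound_le_bin (ltnW ta) (ltnW tb) _ le).
  apply: leq_trans le; rewrite -sumE.
  by move: A0 B0; clear; lia.
have [A1|A1] := eqVneq #|cA| 1.
  left; have /cards1P[A AE] : #|cA| == 1 by rewrite A1.
  rewrite AE in p *; have [cAa sub] := cross_pair_le_singleton (ltnW tb) p.
  exists A; rewrite ?ksubsetsTE ?cAa //; split=> //.
  have cardA : #|conbhd t b A|.+1 = cross_bound #|T| a b t.
    by rewrite -cAa card_conbhd // ltnW.
  by apply/eqP; rewrite eqEcard sub /= -ltnS cardA -sumE A1 add1n.
right; have [B1|B1] := eqVneq #|cB| 1.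
  have /cards1P[B BE] : #|cB| == 1 by rewrite B1.
  rewrite BE in p *; have [cBb sub] := cross_pair_le_singleton (ltnW ta) (cross_pairC p).
  have cardB : #|conbhd t a B|.+1 = cross_bound #|T| b a t.
    by rewrite -cBb card_conbhd // ltnW.
  have le : cross_bound #|T| a b t <= cross_bound #|T| b a t.
    by rewrite -sumE -cardB B1 addn1 ltnS subset_leq_card.
  have eq_ab := swap_bin le.
  split=> //; constructor 1; exists B; rewrite ?ksubsetsTE ?cBb //; split=> //.
  apply/eqP; rewrite eqEcard sub /= -ltnS cardB -addn1 -B1 sumE.
  by rewrite cross_bound_eq //; apply/andP; split; move: ta tb abn; clear; lia.
have nt : nontrivial a b (cross_bound #|T| a b t) cA cB.
  by apply/and4P; split; rewrite ?sumE // ltn_neqAle eq_sym ?A1 ?B1.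
have mx : cross_max a b (cross_bound #|T| a b t).
  by move=> S R; apply: cross_pair_sum_le.
have [m [mm sides]] := nontrivial_params adm mx nt.
have [mE ab par] : [/\ m = #|T|.-1, a = b &
    [/\ b = 2 & t = 1] \/ [/\ b = #|T| - 2 & t = #|T| - 3]].
  case: sides => [[_ /exceptional_params]|[le ex]]; first by apply.
  have eq_ab := swap_bin le.
  have [|-> ba] := exceptional_params b1 a1 (admissibleC adm) _ ex; first by rewrite eq_ab.
  by rewrite -ba.
subst b; split=> //.
have sumE' : cross_bound #|T| a a t = (#|T|.-1).*2.
  by case: par => [[-> ->]|[-> ->]]; [apply: cross_bound_star | apply: cross_bound_costar].
(* Both sides have at least [m = #|T|.-1] members and the total is twice that. So every nontrivial
   maximum pair has both sides of minimal size, and the shape result applies to each side. *)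
have half S R : nontrivial a a (cross_bound #|T| a a t) S R ->
    #|S| = #|T|.-1 /\ #|R| = #|T|.-1.
  move=> ntSR; have [] := mm _ _ ntSR; case/and4P: ntSR => _ /eqP + _ _.
  by rewrite sumE' mE; clear; lia.
have shape S R : nontrivial a a (cross_bound #|T| a a t) S R ->
  ([/\ t = 1, a = 2 & exists2 E : {set T}, #|E| = a.-1 &
      S = [set A in ksubsets [set: T] a | E \subset A]] \/
   [/\ t = a.-1, a = #|T| - 2 & exists2 E : {set T}, #|E| = a.+1 & S = ksubsets E a]).
  move=> ntSR; have [SE RE] := half _ _ ntSR.
  have [||//] := nontrivial_shape adm mx ntSR; first by rewrite SE RE.
  by move=> S' R' /half[S'E _]; rewrite SE S'E.
have cr : cross_intersecting t cA cB by case/cross_pairP: p.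
have [[t1 a2 [E cE cAE]]|[tE aE [E cE cAE]]] := shape _ _ nt;
  have [[t1' a2' [F cF cBF]]|[tE' aE' [F cF cBF]]] := shape _ _ (nontrivialC nt).
- constructor 2; split=> //; rewrite cAE cBF t1 a2 in cr.
  have [||i Ei Fi] := cross_star_eq n3 _ _ cr; [by rewrite cE a2|by rewrite cF a2|].
  by exists i; rewrite cAE cBF Ei Fi a2; split; apply/setP=> C; rewrite !inE sub1set.
(* Mixed shapes would need [a = 2 = #|T| - 2] with [t = 1], the excluded case [a + b = #|T|]. *)
- by case: nd; split=> //; move: a2 aE' n3; clear; lia.
- by case: nd; split=> //; move: a2' aE n3; clear; lia.
constructor 3.
have aT : a.+1 = #|T|.-1 by move: aE n3; clear; lia.
have tT : t = #|T| - 3 by move: tE aE; clear; lia.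
split=> //; rewrite cAE cBF {1}tT aE in cr.
have EF := cross_costar_eq n3 (etrans cE aT) (etrans cF aT) cr.
exists E; first by rewrite ksubsetsTE cE aT subn1.
by rewrite cAE cBF -EF -aE.
Qed.

End CrossTheorem.

Theorem theorem1p2 (n a b t : nat) (cA cB : {set {set 'I_n}})
    (hn : 4 <= n) (ha : 2 <= a) (hb : 2 <= b) (ht : 0 < t)
    (htab : t < minn a b) (habn : a + b < n + t)
    (hnt : (n, t) <> (a + b, 1)) (hbin : 'C(n, a) <= 'C(n, b))
    (hcA : cA \subset ksubsets [set: 'I_n] a)
    (hcB : cB \subset ksubsets [set: 'I_n] b)
    (hcA0 : cA != set0) (hcB0 : cB != set0)
    (hcross : cross_intersecting t cA cB) :
  [/\ #|cA| + #|cB| <= cross_bound n a b t,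
      'C(n, a) < 'C(n, b) ->
        (#|cA| + #|cB| = cross_bound n a b t <->
         exists2 A : {set 'I_n}, A \in ksubsets [set: 'I_n] a &
           cA = [set A] /\ cB = ksubsets [set: 'I_n] b :\: nbhd t b A)
    & 'C(n, a) = 'C(n, b) ->
        (#|cA| + #|cB| = cross_bound n a b t <->
         [\/ exists2 A : {set 'I_n}, A \in ksubsets [set: 'I_n] a &
               cA = [set A] /\ cB = ksubsets [set: 'I_n] b :\: nbhd t b A,
             exists2 B : {set 'I_n}, B \in ksubsets [set: 'I_n] b &
               cB = [set B] /\ cA = ksubsets [set: 'I_n] a :\: nbhd t a B,
             [/\ a = 2, b = 2, t = 1 &
               exists i : 'I_n,
                 cA = [set C in ksubsets [set: 'I_n] 2 | i \in C] /\
                 cB = [set C in ksubsets [set: 'I_n] 2 | i \in C]]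
           | [/\ a = n - 2, b = n - 2, t = n - 3 &
               exists2 A : {set 'I_n}, A \in ksubsets [set: 'I_n] (n - 1) &
                 cA = ksubsets A (n - 2) /\ cB = ksubsets A (n - 2)]])].
Proof.
have [ta tb] : t < a /\ t < b by move: htab; rewrite leq_min => /andP.
have p : cross_pair t a b cA cB.
  apply/cross_pairP; split=> // [A /(subsetP hcA)|B /(subsetP hcB)];
    by rewrite ksubsetsTE => /eqP.
have nd : ~ (a + b = n /\ t = 1) by case=> abn t1; apply: hnt; rewrite abn t1.
have n3 : 3 < #|'I_n| by rewrite card_ord.
have le_ab : 'C(#|'I_n|, a) <= 'C(#|'I_n|, b) by rewrite card_ord.
have adm : [/\ 0 < t, t < a, t < b, a + b < #|'I_n| + t & ~ (a + b = #|'I_n| /\ t = 1)].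
  by rewrite card_ord; split.
have bound := cross_pair_sum_le adm le_ab p; rewrite card_ord in bound.
have cases := equality_cases ha hb n3 adm le_ab p; rewrite card_ord in cases.
have form1 (A : {set 'I_n}) : A \in ksubsets [set: 'I_n] a ->
    cA = [set A] /\ cB = conbhd t b A -> #|cA| + #|cB| = cross_bound n a b t.
  rewrite ksubsetsTE => /eqP cAa [-> ->].
  rewrite cards1 add1n -cAa card_conbhd ?card_ord //; exact: ltnW.
split=> // [lt_ab|eq_ab]; split.
- by case/cases=> // -[eq_ab _]; rewrite eq_ab ltnn in lt_ab.
- by case=> A; apply: form1.
- by case/cases=> [h|[_ [h|h|h]]]; [apply: Or41|apply: Or42|apply: Or43|apply: Or44].
case=> [[A]||[a2 b2 t1 [i [-> ->]]]|[a2 b2 t1 [A + [-> ->]]]].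
- exact: form1.
- case=> B; rewrite ksubsetsTE => /eqP cBb [-> ->].
  have := @cross_bound_eq 'I_n t a b; rewrite card_ord => -> //.
  + rewrite cards1 addn1 -cBb card_conbhd ?card_ord //; exact: ltnW.
  + by move: ta tb habn; clear; lia.
  + by move: ta tb habn; clear; lia.
(* Written as a star on the one-point set [[set i]], so that [card_star] gives [n - 1] for each
   side. *)
- have -> : [set C in ksubsets [set: 'I_n] 2 | i \in C] =
            [set C in ksubsets [set: 'I_n] 2 | [set i] \subset C].
    by apply/setP=> C; rewrite !inE sub1set.
  rewrite a2 b2 t1 cross_bound_star // card_star ?cards1 ?card_ord //.
    by move: hn; clear; lia.
  by move: hn; clear; lia.
rewrite ksubsetsTE => /eqP cAn; rewrite a2 b2 t1 cross_bound_costar //.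
rewrite cards_draws cAn (_ : n - 2 = n - 1 - 1); last by move: hn; clear; lia.
rewrite bin_sub ?bin1 //.
  by move: hn; clear; lia.
by move: hn; clear; lia.
Qed.
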